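(* Let $p\ge 5$ be a prime and let $s\ge 1$ be an integer. Then there exists an integer $M$ such that for every quadratic polynomial $f=f_2X^2+f_1X+f_0$ with coefficients $f_2,f_1,f_0$ in $\mathbb{Z}/p^s\mathbb{Z}$ such that $f$ is not the square of a polynomial in $(\mathbb{Z}/p^s\mathbb{Z})[X]$, and for every integer $N\ge 0$: if each of $f(1),f(2),\dots,f(N)$ is a square in $\mathbb{Z}/p^s\mathbb{Z}$, then $N\le M$.
   Context: A ''quadratic polynomial'' means an expression $f_2X^2+f_1X+f_0$; no invertibility or other restriction is placed on $f_2$. The element $0$ counts as a square. *)

(* Defs.v *)
From HB Require Import structures.
From mathcomp Require Import all_boot all_order all_algebra.
Set Implicit Arguments.
Unset Strict Implicit.
Unset Printing Implicit Defensive.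
Import GRing.Theory.
Local Open Scope ring_scope.

(* Applied to [{poly R}], the root is a polynomial of arbitrary degree: over a
   ring with nilpotents it can have larger degree than the polynomial itself. *)
Definition is_square (R : pzSemiRingType) (x : R) : Prop :=
  exists y : R, x = y ^+ 2.

(* Main.v *)
Require Import Defs.
From HB Require Import structures.
From mathcomp Require Import all_boot all_order all_algebra.
From mathcomp Require Import ring zify.
Set Implicit Arguments.
Unset Strict Implicit.
Unset Printing Implicit Defensive.
Import GRing.Theory.
Local Open Scope ring_scope.

(** All elements of Z/p^s are values at integers, so [M = 2 p^s] works as soon as a
    quadratic polynomial all of whose values are squares is itself a square.
    Write [q] for the class of [p] and [f = q^a g] with [g] primitive.
    If the leading coefficient of [g] is a unit, complete the square,
    [f = q^a u2 ((X - r)^2 + d)]: when [q^a d = 0] the value at [r + 1] gives a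
    square root, otherwise rescaling [X - r] shows that [u2 z^2 + e] with [e] a unit
    is always a square modulo [p], which is impossible for [p >= 5].  If [g] is
    linear modulo [p] it takes nonsquare unit values.  If [g] is a nonzero constant
    modulo [p], then [f = f(0) (1 + n)] with [n] nilpotent, and [1 + n] has a square
    root given by the truncated binomial series. *)

(** * Square roots of one plus a nilpotent *)

Lemma is_squareM (R : comPzSemiRingType) (x y : R) :
  is_square x -> is_square y -> is_square (x * y).
Proof. by move=> [a ->] [b ->]; exists (a * b); rewrite exprMn. Qed.

(** Half is passed as [h], so that the lemma serves both [R] and [{poly R}]. *)
Lemma is_square_1D_nilpotent (R : comNzRingType) (h n : R) (k : nat) :
  h *+ 2 = 1 -> n ^+ k = 0 -> is_square (1 + n).
Proof.
move=> h2 nk0.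
have approx j : exists t r : R, 1 + n = (1 + n * t) ^+ 2 + n ^+ j.+1 * r.
  elim: j => [|j [t [r e]]]; first by exists 0, 1; ring.
  (* Adding half of the error to the root cancels it and leaves an error divisible by one more power
     of [n]. *)
  exists (t + n ^+ j * r * h), (- (r * t) - n ^+ j * r ^+ 2 * h ^+ 2).
  rewrite {1}e !exprS.
  have -> : n * n ^+ j * r = (h *+ 2) * (n * n ^+ j * r) by rewrite h2 mul1r.
  have -> : - (r * t) = - ((h *+ 2) * (r * t)) by rewrite h2 mul1r.
  by ring.
have [t [r ->]] := approx k.
by exists (1 + n * t); rewrite [n ^+ _.+1]exprS nk0 mulr0 mul0r addr0.
Qed.

(** * Finite local rings with maximal ideal generated by a nilpotent [q] *)

Section ChainRing.

Variables (R : finComUnitRingType) (q : R) (s : nat).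
Hypothesis qs0 : q ^+ s = 0.
Hypothesis valuation :
  forall x : R, exists (k : nat) (u : R), u \is a GRing.unit /\ x = q ^+ k * u.
Hypothesis unit2 : (2%:R : R) \is a GRing.unit.
Hypothesis unit3 : (3%:R : R) \is a GRing.unit.
Hypothesis natr_surj : forall x : R, exists n : nat, x = n%:R.

Lemma half_double : (2%:R : R)^-1 *+ 2 = 1.
Proof. by rewrite -[LHS]mulr_natr mulVr. Qed.

Lemma is_square_1DqM (x : R) : is_square (1 + q * x).
Proof.
apply: (@is_square_1D_nilpotent _ 2%:R^-1 _ s); first exact: half_double.
by rewrite exprMn qs0 mul0r.
Qed.

Lemma unit_1DqM (x : R) : 1 + q * x \is a GRing.unit.
Proof.
apply/unitrPr; exists (\sum_(i < s) (- (q * x)) ^+ i).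
have := subrX1 (- (q * x)) s.
rewrite exprNn exprMn qs0 mul0r mulr0 sub0r => /(congr1 -%R).
by rewrite opprK -mulNr opprB opprK => <-.
Qed.

Lemma unitDqM (u x : R) : u \is a GRing.unit -> u + q * x \is a GRing.unit.
Proof.
move=> uu; have -> : u + q * x = u * (1 + q * (u^-1 * x)).
  by rewrite mulrDr mulr1 mulrCA mulVKr.
by rewrite unitrM uu unit_1DqM.
Qed.

Lemma nonunitP (x : R) : x \isn't a GRing.unit -> exists t, x = q * t.
Proof.
have [[|k] [u [uu ->]]] := valuation x; first by rewrite mul1r uu.
by move=> _; exists (q ^+ k * u); rewrite exprS mulrA.
Qed.

Lemma is_squareDqM (u x : R) :
  u \is a GRing.unit -> is_square u -> is_square (u + q * x).
Proof.
move=> uu squ; have -> : u + q * x = u * (1 + q * (u^-1 * x)).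
  by rewrite mulrDr mulr1 mulrCA mulVKr.
by apply: is_squareM squ (is_square_1DqM _).
Qed.

(* By Hensel's lemma, these are the elements that are squares in the residue field. *)
Definition res_square (x : R) : bool :=
  (x \is a GRing.unit) ==> [exists y, x == y ^+ 2].

Lemma res_squareP (x : R) :
  res_square x <-> (x \is a GRing.unit -> is_square x).
Proof.
split=> [/implyP H /H /existsP[y /eqP ->]|H]; first by exists y.
by apply/implyP => /H [y ->]; apply/existsP; exists y.
Qed.

Lemma res_square_square (x : R) : is_square x -> res_square x.
Proof. by move=> H; apply/res_squareP. Qed.

Lemma res_squareX2 (x : R) : res_square (x ^+ 2).
Proof. by apply: res_square_square; exists x. Qed.

Lemma res_square0 : res_square 0.
Proof. by have := res_squareX2 0; rewrite expr0n. Qed.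

Lemma res_squareDqM (x t : R) : res_square x -> res_square (x + q * t).
Proof.
move=> /res_squareP H; apply/res_squareP => uxt.
have ux : x \is a GRing.unit.
  by have := unitDqM (- t) uxt; rewrite mulrN addrK.
exact: is_squareDqM (H ux).
Qed.

Lemma res_squareM (x y : R) :
  res_square x -> res_square y -> res_square (x * y).
Proof.
move=> /res_squareP Hx /res_squareP Hy; apply/res_squareP.
by rewrite unitrM => /andP[/Hx ? /Hy ?]; apply: is_squareM.
Qed.

(* Squaring is not injective on the units, since [-1 <> 1]. *)
Lemma res_square_not_all : ~ (forall x : R, res_square x).
Proof.
move=> H.
pose U := [set x : R | x \is a GRing.unit].
have UU : U \subset [set x ^+ 2 | x in U].
  apply/subsetP => x; rewrite inE => ux.
  have /res_squareP/(_ ux)[y ey] := H x.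
  apply/imsetP; exists y => //; rewrite inE.
  by move: ux; rewrite ey unitrX_pos.
have /imset_injP inj : #|[set x ^+ 2 | x in U]| == #|U|.
  by rewrite eqn_leq leq_imset_card subset_leq_card.
have e : (-1 : R) = 1 by apply: inj; rewrite ?inE ?unitrN1 ?unitr1 ?sqrrN.
have : (2%:R : R) = 0 by rewrite mulr2n -{1}e addNr.
by move=> e2; move: unit2; rewrite e2 unitr0.
Qed.

(* [x |-> c x + e] permutes the residue squares, so [-e = c x] for some residue
   square [x], and after scaling the residue squares are stable under
   [x |-> 1 - x].  Applied to [4], [9] and [-2], this makes [-3], [-8], [-2] and
   [3] squares; then so is [-1], and the residue squares are stable under [+ 1]. *)
Lemma quadratic_nonsquare_value (c e : R) :
  c \is a GRing.unit -> e \is a GRing.unit ->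
  ~ (forall z : R, res_square (c * z ^+ 2 + e)).
Proof.
move=> uc ue H.
have e_sq : is_square e.
  by apply/(iffLR (res_squareP _)) => //; have := H 0; rewrite expr0n mulr0 add0r.
pose S := [set x : R | res_square x].
have stable x : x \in S -> c * x + e \in S.
  rewrite !inE => xS; have [ux|/nonunitP[t ->]] := boolP (x \is a GRing.unit).
    by have [y ->] := iffLR (res_squareP x) xS ux.
  by rewrite mulrCA addrC res_squareDqM // res_square_square.
have inj : injective (fun x => c * x + e).
  by move=> x y /addIr /(mulrI uc).
have /eqP imS : [set c * x + e | x in S] == S.
  rewrite eqEcard card_imset // leqnn andbT.
  by apply/subsetP => _ /imsetP[x xS ->]; apply: stable.
have : 0 \in S by rewrite inE res_square0.
rewrite -imS => /imsetP[x]; rewrite inE => xS /esym/eqP.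
rewrite addr_eq0 => /eqP cx.
have ux : x \is a GRing.unit.
  by have := ue; rewrite -unitrN -cx unitrM uc.
have x_sq : is_square x by apply/(iffLR (res_squareP _)).
have [b eb] := e_sq.
have ub : b \is a GRing.unit by move: ue; rewrite eb unitrX_pos.
(* Since [c * x = - e], the map sends [x * y] to [e * (1 - y)], and [e = b ^+ 2] can be divided
   out. *)
have refl1 y : res_square y -> res_square (1 - y).
  move=> yS; have : x * y \in S by rewrite inE res_squareM.
  move/stable; rewrite inE mulrA cx => K.
  have := res_squareM K (res_squareX2 b^-1).
  by rewrite exprVn -eb mulNr addrC -[X in X - _]mulr1 -mulrBr mulrAC divrr // mul1r.
have sq_m3 : res_square (- 3%:R).
  by have := refl1 _ (res_squareX2 2%:R); congr res_square; ring.
have sq_m8 : res_square (- 8%:R).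
  by have := refl1 _ (res_squareX2 3%:R); congr res_square; ring.
have sq_m2 : res_square (- 2%:R).
  have := res_squareM sq_m8 (res_squareX2 2%:R^-1).
  congr res_square; rewrite (_ : 8%:R = 2%:R * 2%:R ^+ 2); last by ring.
  by rewrite mulNr -mulrA -exprMn divrr // expr1n mulr1.
have sq_3 : res_square 3%:R.
  by have := refl1 _ sq_m2; congr res_square; ring.
have sq_m1 : res_square (-1).
  have := res_squareM (res_squareM sq_m3 sq_3) (res_squareX2 3%:R^-1).
  by rewrite mulNr -expr2 mulNr -exprMn divrr // expr1n.
have sq_succ y : res_square y -> res_square (1 + y).
  by move=> yS; have := refl1 _ (res_squareM sq_m1 yS); rewrite mulN1r opprK.
apply: res_square_not_all => y; have [n ->] := natr_surj y.
elim: n => [|n IHn]; last by rewrite -natr1 addrC sq_succ.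
exact: res_square0.
Qed.

(** Compare the exponent [a] with the exponent [2b] of the square. If they differ, factoring out the
    smaller power leaves a unit, so that power vanishes and [q ^+ a = 0]. If they agree,
    [x - v ^+ 2] is killed by [q ^+ a], hence is a multiple of [q], and the root [v] lifts. *)
Lemma square_qXM (a : nat) (x : R) :
  q ^+ a != 0 -> x \is a GRing.unit -> is_square (q ^+ a * x) ->
  ~~ odd a /\ is_square x.
Proof.
move=> qa ux [z]; have [b [v [uv ->]]] := valuation z.
rewrite exprMn -exprM muln2 => e.
have uv2 : v ^+ 2 \is a GRing.unit by rewrite unitrX_pos.
have cancel_unit k y : y \is a GRing.unit -> q ^+ k * y = 0 -> q ^+ k = 0.
  by move=> uy; rewrite -[X in _ = X](mul0r y) => /(mulIr uy).
have [ab|ba|ab] := ltngtP a b.*2.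
- have [j jE] : exists j, b.*2 = (a + j.+1)%N by exists (b.*2 - a).-1; lia.
  case/eqP: qa; apply: (cancel_unit a (x + q * - (q ^+ j * v ^+ 2))).
    exact: unitDqM.
  by rewrite mulrDr e jE exprD exprS; ring.
- have [j jE] : exists j, a = (b.*2 + j.+1)%N by exists (a - b.*2).-1; lia.
  case/eqP: qa; rewrite jE exprD.
  rewrite (cancel_unit b.*2 (v ^+ 2 + q * - (q ^+ j * x))) ?mul0r //.
    exact: unitDqM.
  by rewrite mulrDr -e jE exprD exprS; ring.
- split; first by rewrite ab odd_double.
  have [uvx|/nonunitP[t et]] := boolP (x - v ^+ 2 \is a GRing.unit).
    case/eqP: qa; apply: cancel_unit uvx _.
    by rewrite mulrBr e -ab subrr.
  rewrite -[x](subrK (v ^+ 2)) addrC et.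
  by apply: is_squareDqM => //; exists v.
Qed.

Lemma res_square_qXM (a : nat) (x : R) :
  q ^+ a != 0 -> is_square (q ^+ a * x) -> res_square x.
Proof. by move=> qa H; apply/res_squareP => ux; have [] := square_qXM qa ux H. Qed.

(** * Quadratic polynomials all of whose values are squares *)

Lemma poly_square_unit_lead (a : nat) (u g1 g0 : R) :
  u \is a GRing.unit ->
  (forall x, is_square (q ^+ a * (u * x ^+ 2 + g1 * x + g0))) ->
  is_square ((q ^+ a * u) *: 'X^2 + (q ^+ a * g1) *: 'X + (q ^+ a * g0)%:P).
Proof.
move=> uu H.
pose m := - (g1 * 2%:R^-1 * u^-1); pose d := g0 * u^-1 - m ^+ 2.
have g1E : g1 = - (2%:R * u * m).
  by rewrite /m mulrN opprK [RHS]mulrC [2%:R * u]mulrC mulrA !divrK.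
have g0E : g0 = u * (m ^+ 2 + d).
  by rewrite /d addrC subrK mulrC divrK.
have H' z : is_square (q ^+ a * (u * (z ^+ 2 + d))).
  by have := H (m + z); congr is_square; rewrite g1E g0E; ring.
have [qd|qd] := eqVneq (q ^+ a * d) 0.
  have [y ey] := H' 1.
  have qu : q ^+ a * u = y ^+ 2.
    by rewrite -ey expr1n mulrDr mulr1 mulrDr mulrCA qd mulr0 addr0.
  exists (y%:P * ('X - m%:P)).
  have -> : q ^+ a * g1 = - (2%:R * y ^+ 2 * m) by rewrite g1E -qu; ring.
  have -> : q ^+ a * g0 = y ^+ 2 * m ^+ 2.
    by rewrite g0E -qu -(addr0 (q ^+ a * u * m ^+ 2)) -(mulr0 u) -qd; ring.
  by rewrite qu -!mul_polyC; ring.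
have [k [v [uv dE]]] := valuation d.
have qak : q ^+ (a + k) != 0.
  by apply: contra_neq qd => e; rewrite dE mulrA -exprD e mul0r.
have qa : q ^+ a != 0 by apply: contra_neq qak; rewrite exprD => ->; rewrite mul0r.
(* For [k > 0], the value at [z = 0] has exponent [a + k] and the value at [z = 1] has exponent [a],
   because [1 + d] is then a unit. Both exponents are even. *)
have even_k : ~~ odd k.
  case: k => [//|k] in dE qak *.
  have even_ak : ~~ odd (a + k.+1).
    apply: (proj1 (square_qXM (x := u * v) qak _ _)); first by rewrite unitrM uu.
    have := H' 0; congr is_square.
    by rewrite expr0n add0r dE exprD; ring.
  have : ~~ odd a.
    apply: (proj1 (square_qXM (x := u * (1 + q * (q ^+ k * v))) qa _ _)).
      by rewrite unitrM uu unit_1DqM.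
    by have := H' 1; rewrite dE (exprS q) expr1n -mulrA.
  by move: even_ak; rewrite oddD; case: (odd a).
have [j kE] : exists j, k = (j + j)%N by exists k./2; rewrite addnn even_halfK.
case: (@quadratic_nonsquare_value u (u * v)) => // [|z].
  by rewrite unitrM uu.
apply: (res_square_qXM qak).
(* With [k = 2j], this substitution pulls [q ^+ k] out of both terms of [z ^+ 2 + d]. *)
have := H' (q ^+ j * z); congr is_square.
by rewrite dE kE !exprD; ring.
Qed.

Lemma poly_square_of_values (f2 f1 f0 : R) :
  (forall x, is_square (f2 * x ^+ 2 + f1 * x + f0)) ->
  is_square (f2 *: 'X^2 + f1 *: 'X + f0%:P).
Proof.
have [k2 [u2 [U2 ->]]] := valuation f2.
have [k1 [u1 [U1 ->]]] := valuation f1.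
have [k0 [u0 [U0 ->]]] := valuation f0.
move=> H.
(* Factor out the smallest of the three exponents, ties going to the higher degree. *)
have [/andP[k21 k20]|n2] := boolP ((k2 <= k1) && (k2 <= k0))%N.
  move: H; rewrite -(subnKC k21) -(subnKC k20) !exprD -!mulrA => H.
  apply: poly_square_unit_lead => // x.
  by have := H x; congr is_square; ring.
have [/andP[k12 k10]|n1] := boolP ((k1 < k2) && (k1 <= k0))%N.
  have [e|qk] := eqVneq (q ^+ k1) 0.
    rewrite -(subnKC k12) -(subnKC k10) exprD exprS exprD e.
    by exists 0; rewrite mulr0 !mul0r !scale0r !addr0 expr0n.
  case: res_square_not_all => y.
  pose j := (k2 - k1.+1)%N; pose i := (k0 - k1)%N.
  (* At this point the linear part takes the value [y], and the quadratic term is a multiple of [q];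
     so an arbitrary [y] would be a residue square. *)
  pose x := u1^-1 * (y - q ^+ i * u0).
  have yE : y = u1 * x + q ^+ i * u0 by rewrite /x mulVKr // subrK.
  have : res_square (y + q * (q ^+ j * u2 * x ^+ 2)).
    apply: (res_square_qXM qk).
    have := H x; congr is_square.
    by rewrite {1}yE -(subnKC k12) -(subnKC k10) -/i -/j exprD exprS exprD; ring.
  by move/(res_squareDqM (- (q ^+ j * u2 * x ^+ 2))); rewrite mulrN addrK.
have [k01 k02] : (k0 < k1)%N /\ (k0 < k2)%N by lia.
have := H 0; rewrite expr0n !mulr0 !add0r => -[y ey].
rewrite -(subnKC k01) -(subnKC k02).
set j := (k2 - k0.+1)%N; set i := (k1 - k0.+1)%N.
(* The polynomial equals [f(0) * (1 + g)] even though [q ^+ k0] need not be invertible: the other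
   coefficients are multiples of [q ^+ k0.+1]. *)
pose g : {poly R} := q%:P * ((q ^+ j * u2 * u0^-1) *: 'X^2 + (q ^+ i * u1 * u0^-1) *: 'X).
have -> : (q ^+ (k0.+1 + j) * u2) *: 'X^2 + (q ^+ (k0.+1 + i) * u1) *: 'X
          + (q ^+ k0 * u0)%:P = (y ^+ 2)%:P * (1 + g).
  have uE : u0 * u0^-1 = 1 by rewrite divrr.
  have e t w : q ^+ (k0.+1 + t) * w = y ^+ 2 * (q * (q ^+ t * w * u0^-1)).
    by rewrite -ey exprD exprS -[LHS]mulr1 -uE; ring.
  by rewrite !e ey /g -!mul_polyC; ring.
apply: is_squareM; first by exists y%:P; rewrite -rmorphXn.
apply: (@is_square_1D_nilpotent _ (2%:R^-1)%:P _ s).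
  by rewrite -polyCMn half_double.
by rewrite exprMn -polyC_exp qs0 mul0r.
Qed.

End ChainRing.

(** * The ring Z/p^s *)

Lemma Zp_valuation (p s : nat) (x : 'Z_(p ^ s)%N) :
  prime p -> (0 < s)%N ->
  exists (k : nat) (u : 'Z_(p ^ s)%N),
    u \is a GRing.unit /\ x = p%:R ^+ k * u.
Proof.
move=> hp hs.
have gt1 : (1 < p ^ s)%N by rewrite -(exp1n s) ltn_exp2r // prime_gt1.
have [x0|x_gt0] := posnP x.
  exists s, 1; split; first exact: unitr1.
  by rewrite mulr1 -natrX pchar_Zp //; apply/val_inj.
have [m cpm xE] := pfactor_coprime hp x_gt0; case: (logn p x) xE => [|k] xE.
  by exists 0%N, x; rewrite -{1}(natr_Zp x) unitZpE // xE muln1 coprimeXl // mul1r.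
exists k.+1, m%:R; split; first by rewrite unitZpE // coprimeXl.
by rewrite -[LHS]natr_Zp xE natrM natrX mulrC.
Qed.

Theorem mainTheorem1 (p s : nat) (hp : prime p) (hp5 : (5 <= p)%N)
    (hs : (1 <= s)%N) :
  exists M : int,
    forall f2 f1 f0 : 'Z_(p ^ s)%N,
      let f : {poly 'Z_(p ^ s)%N} := f2 *: 'X^2 + f1 *: 'X + f0%:P in
      ~ is_square f ->
      forall N : nat,
        (forall n : nat, (1 <= n <= N)%N -> is_square f.[n%:R]) ->
        N%:Z <= M.
Proof.
have gt1 : (1 < p ^ s)%N by rewrite -(exp1n s) ltn_exp2r // prime_gt1.
exists (p ^ s).*2%:Z => f2 f1 f0 f nsq N sqN.
rewrite lez_nat leqNgt; apply/negP => ltN; apply: nsq.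
apply: (@poly_square_of_values _ p%:R s).
- by rewrite -natrX pchar_Zp.
- by move=> x; apply: Zp_valuation.
- by rewrite unitZpE // coprimeXl // prime_coprime // gtnNdvd //; lia.
- by rewrite unitZpE // coprimeXl // prime_coprime // gtnNdvd //; lia.
- by move=> x; exists x; rewrite natr_Zp.
(* The shift by [p ^ s] keeps the sample point at least 1 when [x = 0], and the point stays below
   [2 * p ^ s], hence below [N]. *)
move=> x; have := sqN (p ^ s + x)%N.
rewrite natrD pchar_Zp // add0r natr_Zp /f !hornerE; apply.
have : (x < p ^ s)%N by rewrite -[X in (_ < X)%N](Zp_cast gt1) ltn_ord.
lia.
Qed.
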